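(* Let $c\in(1/2,1)$ and let $n_0$ be a positive integer such that $cn_0$ is an integer. Suppose there is a complete geometric graph on $n_0$ points whose edge set can be partitioned into $cn_0$ plane star-forests in such a way that every vertex is the center of at least one star (component) of at least one of these star-forests. Then for every integer $k\ge 1$ there exists a complete geometric graph on $kn_0$ points whose edge set can be partitioned into $ckn_0$ plane star-forests.
   Context: A complete geometric graph on a finite point set $P\subset\mathbb{R}^2$ in general position (no three points collinear) is the complete graph with vertex set $P$ whose edges are drawn as straight line segments. A subgraph is plane if no two of its edges cross (i.e. any two of its segments meet at most in a common endpoint). A star is a connected graph on $m\ge 1$ vertices with one vertex (the center) of degree $m-1$ and all others of degree $1$; a single vertex is a star with itself as center, and for a single edge one endpoint is designated as center. A star-forest is a forest each of whose components is a star. *)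

(* Defs.v *)
(* The Euclidean plane is taken as 'rV[R]_2 for R : realType. *)
From HB Require Import structures.
From mathcomp Require Import all_boot all_order all_algebra.
From mathcomp Require Import reals.

Set Implicit Arguments.
Unset Strict Implicit.
Unset Printing Implicit Defensive.

Import Order.TTheory GRing.Theory Num.Theory.
Local Open Scope ring_scope.

(* A finite simple graph whose vertices form a subset of T, so that a value of
   [graph T] is exactly a subgraph of the complete graph on T. *)
Record graph (T : finType) := Graph {
  verts : {set T};
  edges : {set {set T}};
  edgesP : edges \subset [set e : {set T} | (e \subset verts) && (#|e| == 2)]
}.

Section Graphs.
Variable T : finType.
Implicit Types (G F : graph T) (x y c : T) (C : {set T}).

Definition complete_graph : graph T :=
  @Graph T setT [set e : {set T} | (e \subset setT) && (#|e| == 2)]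
         (subxx _).

Definition adj G : rel T := [rel x y | [set x; y] \in edges G].

Definition degree G x : nat := #|[set y | adj G x y]|.

Definition connected G : Prop :=
  {in verts G &, forall x y, connect (adj G) x y}.

Definition component_verts G x : {set T} :=
  [set y in verts G | connect (adj G) x y].

Definition component_edges G x : {set {set T}} :=
  [set e in edges G | e \subset component_verts G x].

Lemma component_edgesP G x :
  component_edges G x
    \subset [set e : {set T} | (e \subset component_verts G x) && (#|e| == 2)].
Proof.
apply/subsetP=> e; rewrite !inE => /andP[eG ->] /=.
by have := subsetP (edgesP G) _ eG; rewrite inE => /andP[].
Qed.

(* The connected component of G containing x, meaningful for x \in verts G. *)
Definition component G x : graph T := Graph (component_edgesP G x).

(* The degree condition is stated as an addition because subtraction on nat is
   truncated. *)
Definition star_centered_at G c : Prop :=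
  [/\ connected G, c \in verts G, (degree G c).+1 = #|verts G|
    & forall y, y \in verts G -> y != c -> degree G y = 1%N].

Definition forest G : Prop :=
  forall s : seq T, (2 < size s)%N -> ~ ucycle (adj G) s.

Definition star_forest F : Prop :=
  forest F /\
  forall x, x \in verts F -> exists c, star_centered_at (component F x) c.

(* C picks one center in each component of F.  The choice is forced except on
   components with a single edge, where either endpoint may be picked, but not
   both. *)
Definition center_designation F C : Prop :=
  C \subset verts F /\
  forall x, x \in verts F ->
    exists2 c, C :&: verts (component F x) = [set c]
             & star_centered_at (component F x) c.

(* Blocks may be edgeless: a star-forest may consist of isolated vertices. *)
Definition edge_partition G (m : nat) (F : 'I_m -> graph T) : Prop :=
  \bigcup_(i < m) edges (F i) = edges G /\
  forall i j, i != j -> [disjoint edges (F i) & edges (F j)].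

End Graphs.

Section Plane.
Variable R : realType.
Local Notation point := 'rV[R]_2.

Definition on_line (a v z : point) : Prop := exists t : R, z = a + t *: v.

Definition collinear (x y z : point) : Prop :=
  exists a v : point,
    [/\ v != 0, on_line a v x, on_line a v y & on_line a v z].

Definition on_segment (a b z : point) : Prop :=
  exists2 t : R, 0 <= t <= 1 & z = (1 - t) *: a + t *: b.

Definition general_position (T : finType) (p : T -> point) : Prop :=
  injective p /\
  forall i j k, i != j -> j != k -> i != k -> ~ collinear (p i) (p j) (p k).

(* The subgraph G, drawn with vertices p x and straight edges, has no
   crossing. *)
Definition plane (T : finType) (p : T -> point) (G : graph T) : Prop :=
  forall i j k l : T,
    [set i; j] \in edges G -> [set k; l] \in edges G ->
    [set i; j] != [set k; l] ->
    forall z, on_segment (p i) (p j) z -> on_segment (p k) (p l) z ->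
      exists2 x, x \in [set i; j] :&: [set k; l] & z = p x.

Definition plane_star_forest_partition (T : finType) (p : T -> point)
    (m : nat) (F : 'I_m -> graph T) : Prop :=
  edge_partition (complete_graph T) F /\
  forall i, star_forest (F i) /\ plane p (F i).

End Plane.

(* Main.v *)
(* Replace every vertex v by a cluster of k points (v, 0), ..., (v, k - 1) very
   close to v, and replace the i-th star-forest by k copies.  In the copy j, an
   edge from a leaf v to a center c becomes the star joining (c, j) to the whole
   cluster of v; over all j this covers every edge between the two clusters.
   The edges inside the cluster of v are covered by choosing one star-forest in
   which v is a center and adding the edges from (v, j) to (v, l), j < l, to its
   copy j: there the vertices (v, l) with l <> j are isolated.
   Disjoint segments with endpoints in general position are strictly separated
   by a line, so they stay disjoint when the clusters are small. *)
Require Import Defs.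
From HB Require Import structures.
From mathcomp Require Import all_boot all_order all_algebra.
From mathcomp Require Import reals.
From mathcomp Require Import ring lra.
Set Implicit Arguments.
Unset Strict Implicit.
Unset Printing Implicit Defensive.
Import Order.TTheory GRing.Theory Num.Theory.
Local Open Scope ring_scope.

(** * Properties that hold for all sufficiently small positive reals *)

Section SmallPositive.
Variable R : realType.

Definition for_small_pos (P : R -> Prop) : Prop :=
  exists2 d, 0 < d & forall t, 0 < t < d -> P t.

Lemma for_small_pos_and (P Q : R -> Prop) :
  for_small_pos P -> for_small_pos Q -> for_small_pos (fun t => P t /\ Q t).
Proof.
move=> [d d0 dP] [e e0 eQ]; exists (Num.min d e); first by rewrite lt_min d0.
by move=> t /andP[t0]; rewrite lt_min => /andP[td te]; split;
  [apply: dP|apply: eQ]; rewrite t0.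
Qed.

Lemma for_small_pos_impl (P Q : R -> Prop) :
  (forall t, P t -> Q t) -> for_small_pos P -> for_small_pos Q.
Proof. by move=> PQ [d d0 dP]; exists d => // t /dP/PQ. Qed.

Lemma for_small_pos_ex (P : R -> Prop) : for_small_pos P -> exists t, P t.
Proof.
move=> [d d0 dP]; exists (d / 2); apply: dP.
by rewrite divr_gt0 //= ltr_pdivrMr // ltr_pMr // ltr1n.
Qed.

Lemma for_small_pos_forall (I : finType) (P : I -> R -> Prop) :
  (forall i, for_small_pos (P i)) -> for_small_pos (fun t => forall i, P i t).
Proof.
move=> iP; suff [d d0 dP] : for_small_pos (fun t =>
    forall i, i \in enum I -> P i t).
  by exists d => // t /dP + i; apply; rewrite mem_enum.
elim: (enum I) => [|i s IHs]; first by exists 1.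
apply: for_small_pos_impl (for_small_pos_and (iP i) IHs) => t [Pi Ps] j.
by rewrite inE => /predU1P[->|/Ps].
Qed.

Lemma for_small_pos_implyl (b : bool) (P : R -> Prop) :
  (b -> for_small_pos P) -> for_small_pos (fun t => b -> P t).
Proof. by case: b => [/(_ isT)|_]; [exact: for_small_pos_impl|exists 1]. Qed.

(** For [t < 1] the last two terms are at least [- (|b| + |c|) * t], and the second bound on [t]
    makes this exceed [- a]. The added 1 keeps the denominator positive when [b = c = 0]. *)
Lemma quadratic_pos (a b c : R) : 0 < a ->
  for_small_pos (fun t => 0 < a + b * t + c * t ^+ 2).
Proof.
move=> a0; have s0 : 0 < `|b| + `|c| + 1 by rewrite ltr_wpDl// addr_ge0.
exists (Num.min 1 (a / (`|b| + `|c| + 1))).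
  by rewrite lt_min ltr01 divr_gt0.
move=> t /andP[t0]; rewrite lt_min ltr_pdivlMr// => /andP[t1 ta].
have := ler_norm (- b); have := ler_norm (- c); rewrite !normrN.
have := normr_ge0 b; have := normr_ge0 c.
move: `|b| `|c| s0 ta => B C s0 ta C0 B0 cC bB.
have lin : - B * t <= b * t by rewrite ler_wpM2r ?(ltW t0)//; lra.
have t1' : 0 <= 1 - t by lra.
have quad : - C * t <= c * t ^+ 2.
  apply: (@le_trans _ _ (- C * t ^+ 2)); first by
    have := mulr_ge0 (mulr_ge0 C0 (ltW t0)) t1'; lra.
  by rewrite ler_wpM2r ?sqr_ge0//; lra.
by lra.
Qed.

(** The nonzero coefficient of lowest degree dominates near 0. If [a] is zero, a factor [t] splits
    off and the remaining linear polynomial is treated in the same way. *)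
Lemma quadratic_neq0 (a b c : R) : c != 0 ->
  for_small_pos (fun t => a + b * t + c * t ^+ 2 != 0).
Proof.
have nz (a' b' c' : R) : a' != 0 ->
    for_small_pos (fun t => a' + b' * t + c' * t ^+ 2 != 0).
  rewrite neq_lt => /orP[a0|/quadratic_pos a0].
    have /quadratic_pos pos : 0 < - a' by rewrite oppr_gt0.
    apply: for_small_pos_impl (pos (- b') (- c')) => t tp.
    by rewrite lt_eqF //; lra.
  by apply: for_small_pos_impl (a0 b' c') => t /gt_eqF ->.
move=> c0; have [->|/nz//] := eqVneq a 0.
have [d d0 dP] : for_small_pos (fun t => b + c * t != 0).
  have [->|/nz bnz] := eqVneq b 0.
    by exists 1 => // t /andP[t0 _]; rewrite add0r mulf_neq0// gt_eqF.
  by apply: for_small_pos_impl (bnz c 0) => t; rewrite mul0r addr0.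
exists d => // t /[dup] /dP bct /andP[t0 _].
have -> : 0 + b * t + c * t ^+ 2 = (b + c * t) * t by ring.
by rewrite mulf_neq0 // gt_eqF.
Qed.

End SmallPositive.

(** * Orientation, separation by lines and perturbation in the plane *)

Section Geometry.
Variable R : realType.
Local Notation point := 'rV[R]_2.
Implicit Types a b c d z : point.

Lemma point_ext a b : a 0 0 = b 0 0 -> a 0 1 = b 0 1 -> a = b.
Proof.
move=> e0 e1; apply/rowP => i; case: i => [[|[|//]]] i.
  by rewrite (_ : Ordinal i = 0) //; apply/val_inj.
by rewrite (_ : Ordinal i = 1) //; apply/val_inj.
Qed.

(** Twice the signed area of the triangle [a b c]; its sign tells on which side of the line [a b]
    the point [c] lies. *)
Definition cross a b c : R :=
  (b 0 0 - a 0 0) * (c 0 1 - a 0 1) - (b 0 1 - a 0 1) * (c 0 0 - a 0 0).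

Lemma collinear_cross a b c : collinear a b c -> cross a b c = 0.
Proof.
by move=> [o [v [_ [x ->] [y ->] [z ->]]]]; rewrite /cross !mxE; ring.
Qed.

Lemma cross_collinear a b c : a != b -> cross a b c = 0 -> collinear a b c.
Proof.
move=> ab abc; exists a, (b - a).
have ba : b - a != 0 by rewrite subr_eq0 eq_sym.
split=> //; first by exists 0; rewrite scale0r addr0.
  by exists 1; rewrite scale1r addrC subrK.
(* The parameter of [c] on the line is read off from a coordinate in which [a] and [b] differ. *)
have [e0|n0] := eqVneq (b 0 0 - a 0 0) 0.
  have n1 : b 0 1 - a 0 1 != 0.
    apply: contra ba => /eqP e1; apply/eqP/point_ext; rewrite !mxE //.
  exists ((c 0 1 - a 0 1) / (b 0 1 - a 0 1)); apply: point_ext; rewrite !mxE.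
    move: abc; rewrite /cross e0 mul0r sub0r mulr0 addr0 => /eqP.
    by rewrite oppr_eq0 mulf_eq0 (negbTE n1) subr_eq0 => /eqP.
  by rewrite divfK// addrC subrK.
exists ((c 0 0 - a 0 0) / (b 0 0 - a 0 0)); apply: point_ext; rewrite !mxE.
  by rewrite divfK// addrC subrK.
move/eqP: abc; rewrite /cross subr_eq0 => /eqP abc.
apply: (mulfI n0); rewrite mulrDr [_ * (_ / _ * _)]mulrA [_ * (_ / _)]mulrC divfK//.
by rewrite [(c 0 0 - _) * _]mulrC -abc; ring.
Qed.

Lemma on_segmentC a b z : on_segment a b z -> on_segment b a z.
Proof.
move=> [t t01 ->]; exists (1 - t); first by lra.
by rewrite opprB addrCA subrr addr0 addrC.
Qed.

(** A common point gives [s *: (a - c) = t *: (b - c)]. These directions are independent, so taking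
    the determinant with [b - c] forces [s = 0]. *)
Lemma segments_share_apex a b c z : cross c a b != 0 ->
  on_segment c a z -> on_segment c b z -> z = c.
Proof.
move=> nz [s _ ->] [t _ e].
have := congr1 (fun w : point => w 0 0) e.
have := congr1 (fun w : point => w 0 1) e; rewrite !mxE => e1 e0.
suff /eqP -> : s == 0 by rewrite subr0 scale1r scale0r addr0.
have /eqP : s * cross c a b = 0.
  rewrite /cross; have -> : s * ((a 0 0 - c 0 0) * (b 0 1 - c 0 1)
    - (a 0 1 - c 0 1) * (b 0 0 - c 0 0)) =
    (s * (a 0 0 - c 0 0)) * (b 0 1 - c 0 1)
      - (s * (a 0 1 - c 0 1)) * (b 0 0 - c 0 0) by ring.
  have -> : s * (a 0 0 - c 0 0) = t * (b 0 0 - c 0 0) by lra.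
  have -> : s * (a 0 1 - c 0 1) = t * (b 0 1 - c 0 1) by lra.
  by ring.
by rewrite mulf_eq0 (negbTE nz) orbF.
Qed.

(** The line where the functional [(u, v)] takes the value [r] has [a], [b] on one side and [c], [d]
    on the other. Unlike mere disjointness of segments, these strict inequalities on the four
    endpoints visibly survive small perturbations. *)
Definition strictly_separated a b c d : Prop :=
  exists u v r : R,
    [/\ u * a 0 0 + v * a 0 1 < r, u * b 0 0 + v * b 0 1 < r,
        r < u * c 0 0 + v * c 0 1 & r < u * d 0 0 + v * d 0 1].

Lemma strictly_separatedC a b c d :
  strictly_separated a b c d -> strictly_separated c d a b.
Proof.
by move=> [u [v [r [ha hb hc hd]]]]; exists (- u), (- v), (- r); split; lra.
Qed.

Lemma strictly_separated_disjoint a b c d z : strictly_separated a b c d ->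
  on_segment a b z -> on_segment c d z -> False.
Proof.
move=> [u [v [r [ha hb hc hd]]]] [s s01 ->] [t t01 e].
have := congr1 (fun w : point => w 0 0) e.
have := congr1 (fun w : point => w 0 1) e; rewrite !mxE => e1 e0.
have : u * ((1 - s) * a 0 0 + s * b 0 0) + v * ((1 - s) * a 0 1 + s * b 0 1)
  = u * ((1 - t) * c 0 0 + t * d 0 0) + v * ((1 - t) * c 0 1 + t * d 0 1).
  by rewrite e0 e1.
have -> : u * ((1 - s) * a 0 0 + s * b 0 0) + v * ((1 - s) * a 0 1 + s * b 0 1)
  = (1 - s) * (u * a 0 0 + v * a 0 1) + s * (u * b 0 0 + v * b 0 1) by ring.
have -> : u * ((1 - t) * c 0 0 + t * d 0 0) + v * ((1 - t) * c 0 1 + t * d 0 1)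
  = (1 - t) * (u * c 0 0 + v * c 0 1) + t * (u * d 0 0 + v * d 0 1) by ring.
move: (u * _ + _) (u * _ + _) (u * _ + _) (u * _ + _) ha hb hc hd => D C B A.
move=> ha hb hc hd; have {s01} /andP[s0 s1] := s01.
have {t01} /andP[t0 t1] := t01.
have : (1 - s) * A + s * B < r by case: (leP A B) => AB; nra.
have : r < (1 - t) * C + t * D by case: (leP C D) => CD; nra.
by lra.
Qed.

(** The functional [(u, v)] is normal to the line [a b]: it equals [o] there and exceeds [o] by
    [cross a b c] at [c]. The line [a b] is therefore shifted towards [c] and [d], half the way to
    the nearer one. *)
Lemma strictly_separated_same_side a b c d :
  0 < cross a b c * cross a b d -> strictly_separated a b c d.
Proof.
pose u := a 0 1 - b 0 1; pose v := b 0 0 - a 0 0.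
pose o := u * a 0 0 + v * a 0 1.
have eC : u * c 0 0 + v * c 0 1 = o + cross a b c.
  by rewrite /o /u /v /cross; ring.
have eD : u * d 0 0 + v * d 0 1 = o + cross a b d.
  by rewrite /o /u /v /cross; ring.
have eB : u * b 0 0 + v * b 0 1 = o by rewrite /o /u /v; ring.
move: (cross a b c) (cross a b d) eC eD => C D eC eD CD.
have [C0|C0] := ltP 0 C.
  have D0 : 0 < D by rewrite pmulr_rgt0 in CD.
  exists u, v, (o + Num.min C D / 2); rewrite eB eC eD -/o.
  have : 0 < Num.min C D by rewrite lt_min C0.
  have : Num.min C D <= C by rewrite ge_min lexx.
  have : Num.min C D <= D by rewrite ge_min lexx orbT.
  by move: (Num.min C D) => M *; split; lra.
have D0 : D < 0 by nra.
have {}C0 : C < 0 by nra.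
exists (- u), (- v), (- o - Num.max C D / 2).
have : Num.max C D < 0 by rewrite gt_max C0.
have : C <= Num.max C D by rewrite le_max lexx.
have : D <= Num.max C D by rewrite le_max lexx orbT.
by move: (Num.max C D) => M *; rewrite /o in eB eC eD *; split; lra.
Qed.

(** The separating line is the perpendicular bisector of [a] and [b]. *)
Lemma strictly_separated_points a b : a != b -> strictly_separated a a b b.
Proof.
move=> ab; pose u := b 0 0 - a 0 0; pose v := b 0 1 - a 0 1.
have uv : 0 < u ^+ 2 + v ^+ 2.
  rewrite lt_neqAle addr_ge0 ?sqr_ge0 // andbT eq_sym.
  rewrite paddr_eq0 ?sqr_ge0 // !sqrf_eq0 !subr_eq0.
  by apply: contra ab => /andP[/eqP e0 /eqP e1]; apply/eqP/point_ext.
exists u, v, (u * a 0 0 + v * a 0 1 + (u ^+ 2 + v ^+ 2) / 2).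
have e : u * b 0 0 + v * b 0 1 = u * a 0 0 + v * a 0 1 + (u ^+ 2 + v ^+ 2).
  by rewrite /u /v; ring.
by rewrite e; split; lra.
Qed.

(* Two segments whose lines both separate the endpoints of the other one meet
   at the point that divides [c, d] in the ratio of the signed areas. *)
Lemma segments_meet a b c d :
  cross a b c * cross a b d < 0 -> cross c d a * cross c d b < 0 ->
  exists2 z, on_segment a b z & on_segment c d z.
Proof.
move=> h1 h2.
have ratio (x y : R) : x * y < 0 -> x - y != 0 /\ 0 <= x / (x - y) <= 1.
  move=> xy; have n : x - y != 0 by apply/eqP => e; nra.
  split=> //; apply/andP; split.
    have -> : x / (x - y) = x * (x - y) / (x - y) ^+ 2 by field.
    by rewrite divr_ge0 ?sqr_ge0 //; nra.
  rewrite -subr_ge0.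
  have -> : 1 - x / (x - y) = - y * (x - y) / (x - y) ^+ 2 by field.
  by rewrite divr_ge0 ?sqr_ge0 //; nra.
have [n1 r1] := ratio _ _ h1; have [n2 r2] := ratio _ _ h2.
exists ((1 - cross c d a / (cross c d a - cross c d b)) *: a
   + (cross c d a / (cross c d a - cross c d b)) *: b).
  by exists (cross c d a / (cross c d a - cross c d b)).
exists (cross a b c / (cross a b c - cross a b d)) => //.
by apply: point_ext; rewrite !mxE; move: n1 n2; rewrite /cross => n1 n2; field;
  rewrite n1 n2.
Qed.

Lemma general_position_cross (T : finType) (p : T -> point) (i j k : T) :
  general_position p -> i != j -> j != k -> i != k ->
  cross (p i) (p j) (p k) != 0.
Proof.
move=> [pI gp] ij jk ik; apply/eqP => /cross_collinear col.
by apply: (gp i j k) => //; apply: col; rewrite (inj_eq pI).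
Qed.

(** If neither line leaves the other segment on one side, both sign products are negative and
    [segments_meet] gives a crossing. The degenerate cases [x = c] and [y = d] are included because
    an edge inside a cluster collapses to a point when the clusters shrink. *)
Lemma disjoint_segments_separated (T : finType) (p : T -> point) (x c y d : T) :
  general_position p ->
  x != y -> x != d -> c != y -> c != d ->
  (x != c -> y != d -> forall z,
    on_segment (p x) (p c) z -> on_segment (p y) (p d) z -> False) ->
  strictly_separated (p x) (p c) (p y) (p d).
Proof.
move=> gp xy xd cy cd disj.
have cr := general_position_cross gp.
have sq (u : R) : u != 0 -> 0 < u * u.
  by move=> u0; rewrite -expr2 exprn_even_gt0 //= u0.
have [xc|xc] := eqVneq x c; have [yd|yd] := eqVneq y d.
- by subst; apply: strictly_separated_points; rewrite (inj_eq gp.1).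
- subst; apply/strictly_separatedC/strictly_separated_same_side/sq.
  by apply: cr; rewrite // eq_sym.
- by subst; apply/strictly_separated_same_side/sq/cr.
have [s1|s1] := ltP 0 (cross (p x) (p c) (p y) * cross (p x) (p c) (p d)).
  exact: strictly_separated_same_side.
have [s2|s2] := ltP 0 (cross (p y) (p d) (p x) * cross (p y) (p d) (p c)).
  exact/strictly_separatedC/strictly_separated_same_side.
have [z z1 z2] : exists2 z, on_segment (p x) (p c) z & on_segment (p y) (p d) z.
  by apply: segments_meet; rewrite lt_neqAle ?s1 ?s2 andbT mulf_neq0 // cr //
    eq_sym.
by case: (disj xc yd z).
Qed.

(** The displacement is [t] times the point [(s, s ^+ 2)] of a parabola. No three points of a
    parabola are collinear, so even points sharing the same [q] are brought into general
    position. *)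
Definition perturb (q : point) (s t : R) : point :=
  \row_j (q 0 j + t * (if j == 0 then s else s ^+ 2)).

Lemma perturbE0 q s t : perturb q s t 0 0 = q 0 0 + t * s.
Proof. by rewrite mxE eqxx. Qed.

Lemma perturbE1 q s t : perturb q s t 0 1 = q 0 1 + t * s ^+ 2.
Proof. by rewrite mxE. Qed.

(* The leading coefficient in t of each orientation determinant is a
   Vandermonde determinant of the parameters s. *)
Lemma perturb_general_position (V : finType) (q : V -> point) (s : V -> R) :
  injective s ->
  for_small_pos (fun t => general_position (fun w => perturb (q w) (s w) t)).
Proof.
move=> sI.
have inj : for_small_pos (fun t => forall x : V * V, x.1 != x.2 ->
    perturb (q x.1) (s x.1) t != perturb (q x.2) (s x.2) t).
  apply: for_small_pos_forall => -[x y]; apply: for_small_pos_implyl => //= xy.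
  have nz : s x - s y != 0 by rewrite subr_eq0 (inj_eq sI).
  (* This quadratic is [t] times the difference of the first coordinates; the extra factor makes
     [s x - s y] the leading coefficient. *)
  have [d d0 dP] := quadratic_neq0 0 (q x 0 0 - q y 0 0) nz.
  exists d => // t td; apply: contraNneq (dP _ td) => e.
  have := congr1 (fun w : point => w 0 0) e; rewrite !perturbE0 => e0.
  have -> : 0 + (q x 0 0 - q y 0 0) * t + (s x - s y) * t ^+ 2 =
    (q x 0 0 + t * s x - (q y 0 0 + t * s y)) * t by ring.
  by rewrite e0 subrr mul0r.
have gp : for_small_pos (fun t => forall x : V * V * V,
    [&& x.1.1 != x.1.2, x.1.2 != x.2 & x.1.1 != x.2] ->
    cross (perturb (q x.1.1) (s x.1.1) t) (perturb (q x.1.2) (s x.1.2) t)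
      (perturb (q x.2) (s x.2) t) != 0).
  apply: for_small_pos_forall => -[[x y] z] /=.
  apply: for_small_pos_implyl => // /and3P[xy yz xz].
  have nz : (s y - s x) * (s z - s x) * (s z - s y) != 0.
    by rewrite !mulf_neq0 // subr_eq0 (inj_eq sI) // eq_sym.
  apply: for_small_pos_impl (quadratic_neq0 (cross (q x) (q y) (q z))
    ((q y 0 0 - q x 0 0) * (s z ^+ 2 - s x ^+ 2)
      + (s y - s x) * (q z 0 1 - q x 0 1)
      - (q y 0 1 - q x 0 1) * (s z - s x)
      - (s y ^+ 2 - s x ^+ 2) * (q z 0 0 - q x 0 0)) nz) => t.
  congr (_ != 0); rewrite /cross !perturbE0 !perturbE1; ring.
apply: for_small_pos_impl (for_small_pos_and inj gp) => t [injt gpt]; split.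
  by move=> x y; apply: contra_eq => xy; apply: (injt (x, y)).
move=> x y z xy yz xz /collinear_cross; apply/eqP.
by apply: (gpt (x, y, z)); rewrite /= xy yz.
Qed.

(** The same line keeps separating: the functional changes linearly in [t] at each point, and the
    four inequalities are strict. *)
Lemma perturb_strictly_separated a b c d (sa sb sc sd : R) :
  strictly_separated a b c d ->
  for_small_pos (fun t => strictly_separated (perturb a sa t) (perturb b sb t)
    (perturb c sc t) (perturb d sd t)).
Proof.
move=> [u [v [r [ha hb hc hd]]]].
have stays (q : point) (s : R) : u * q 0 0 + v * q 0 1 < r ->
    for_small_pos (fun t =>
      u * perturb q s t 0 0 + v * perturb q s t 0 1 < r).
  rewrite -subr_gt0 => /(quadratic_pos (- (u * s + v * s ^+ 2)) 0).
  apply: for_small_pos_impl => t.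
  by rewrite perturbE0 perturbE1; lra.
have stays' (q : point) (s : R) : r < u * q 0 0 + v * q 0 1 ->
    for_small_pos (fun t =>
      r < u * perturb q s t 0 0 + v * perturb q s t 0 1).
  rewrite -subr_gt0 => /(quadratic_pos (u * s + v * s ^+ 2) 0).
  apply: for_small_pos_impl => t.
  by rewrite perturbE0 perturbE1; lra.
have := for_small_pos_and
  (for_small_pos_and (stays a sa ha) (stays b sb hb))
  (for_small_pos_and (stays' c sc hc) (stays' d sd hd)).
apply: for_small_pos_impl => t [[? ?] [? ?]].
by exists u, v, r; split.
Qed.

End Geometry.

(** * Star-forests as idempotent maps *)

Section StarGraph.
Variable T : finType.
Implicit Types (x y : T) (f : T -> T) (G : graph T).

Lemma eq_set2 x y a b : [set x; y] = [set a; b] ->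
  (x = a /\ y = b) \/ (x = b /\ y = a).
Proof.
move=> e; have := set21 x y; have := set22 x y; rewrite e !inE.
have := set21 a b; have := set22 a b; rewrite -e !inE.
by do 4![case/orP=> /eqP ?]; subst; auto.
Qed.

Lemma adjC G x y : adj G x y = adj G y x.
Proof. by rewrite /adj /= setUC. Qed.

Lemma adj_neq G x y : adj G x y -> x != y.
Proof.
move=> /(subsetP (edgesP G)); rewrite inE => /andP[_].
by rewrite cards2; case: (x != y).
Qed.

Lemma adj_verts G x y : adj G x y -> x \in verts G.
Proof.
move=> /(subsetP (edgesP G)); rewrite inE => /andP[/subsetP + _].
by apply; rewrite set21.
Qed.

(** A star-forest is encoded by the map [f] from each vertex to the center of its star. Fixed points
    are the centers, isolated vertices included, and yield no edge of their own. Idempotence of [f]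
    is assumed separately. *)
Definition star_edges f : {set {set T}} :=
  [set [set x; f x] | x in [pred x | f x != x]].

Lemma star_edgesP f :
  star_edges f \subset [set e : {set T} | (e \subset setT) && (#|e| == 2)].
Proof.
apply/subsetP => _ /imsetP[x + ->]; rewrite inE => fx.
by rewrite !inE subsetT cards2 [x == _]eq_sym fx.
Qed.

Definition star_graph f : graph T := Graph (star_edgesP f).

Lemma adj_star_edges f x y : ([set x; y] \in star_edges f) =
  (x != y) && ((f x == y) || (f y == x)).
Proof.
apply/imsetP/andP => [[z + e]|[xy /orP[]/eqP e]].
- rewrite inE => fz; have [[-> ->]|[-> ->]] := eq_set2 e; rewrite eqxx ?orbT //.
  by rewrite eq_sym fz.
- by exists x; rewrite ?inE e // eq_sym.
by exists y; rewrite ?inE e // setUC.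
Qed.

Lemma adj_star f x y :
  adj (star_graph f) x y = (x != y) && ((f x == y) || (f y == x)).
Proof. exact: adj_star_edges. Qed.

Section Idempotent.
Variable f : T -> T.
Hypothesis fK : forall x, f (f x) = f x.
Let G := star_graph f.

Lemma star_adj_center x y : adj G x y -> f x = f y.
Proof. by rewrite adj_star => /andP[_ /orP[]/eqP <-]. Qed.

(** [f] is constant along edges and each [x] is equal or adjacent to [f x], so the components are
    the fibers of [f]. *)
Lemma star_connect x y : connect (adj G) x y = (f x == f y).
Proof.
have sym : connect_sym (adj G) by apply: sym_connect_sym => a b; apply: adjC.
have toc z : connect (adj G) z (f z).
  have [->//|fz] := eqVneq (f z) z.
  by apply: connect1; rewrite adj_star eq_sym fz eqxx.
apply/idP/eqP => [/connectP[p + ->]|e].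
  by elim: p x => //= z p IHp x /andP[/star_adj_center -> /IHp].
by apply: connect_trans (toc x) _; rewrite e sym.
Qed.

Lemma star_component_adj x y z : adj (component G x) y z =
  [&& y != z, (f y == z) || (f z == y), f x == f y & f x == f z].
Proof.
rewrite /adj /= !inE adj_star_edges subUset !sub1set !inE !star_connect.
by rewrite -!andbA.
Qed.

Lemma star_component x : star_centered_at (component G x) (f x).
Proof.
have vE y : (y \in verts (component G x)) = (f x == f y).
  by rewrite !inE star_connect.
split.
- move=> y z; rewrite !vE => /eqP xy /eqP xz.
  have toc w : f x = f w -> connect (adj (component G x)) w (f x).
    move=> xw; have [->//|nw] := eqVneq w (f x).
    by apply: connect1; rewrite star_component_adj nw -xw fK !eqxx.
  apply: connect_trans (toc y xy) _.
  have sym : connect_sym (adj (component G x)).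
    by apply: sym_connect_sym => a b; apply: adjC.
  by rewrite sym; apply: toc.
- by rewrite vE fK.
- rewrite /degree (cardsD1 (f x) (verts _)) vE fK eqxx add1n; congr _.+1.
  apply: eq_card => y; rewrite in_setD1 vE inE star_component_adj fK eqxx /=.
  rewrite [f y == f x]eq_sym [f x == y]eq_sym andbA andbC.
  by case: (f x == f y); rewrite ?orbT ?andbT ?andbF.
- move=> y; rewrite vE => /eqP xy yx; rewrite /degree.
  rewrite (_ : [set z | _] = [set f x]) ?cards1 //; apply/setP => z.
  rewrite !inE [LHS]star_component_adj -xy eqxx /= [z == _]eq_sym.
  have [<-|xz] := eqVneq (f x) z; first by rewrite yx fK eqxx.
  by apply/negbTE; apply: contra yx => /and3P[_ /eqP <- /eqP ->].
Qed.

(** On a cycle [x, y, z, ...] the vertex [y] has two distinct neighbors, so it is a fixed point and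
    [f x = y]. Then [x] is not fixed, its only neighbor is [y], and the edge closing the cycle at
    [x] would have to come from [y]. *)
Lemma star_graph_forest : star_forest G.
Proof.
split; last by move=> x _; exists (f x); apply: star_component.
move=> [|x [|y [|z s]]] // _ /andP[].
rewrite /cycle rcons_cons /= rcons_path -/(adj G) => /and4P[].
move=> xy yz _ lx uniq_s.
have lE : last z s \in z :: s by apply: mem_last.
move: xy yz lx uniq_s lE; rewrite !adj_star => /andP[nxy xy].
move=> /andP[nyz yz] /andP[nlx lx] /and4P[].
rewrite !inE !negb_or => /and3P[_ xz xs] /andP[_ ys] _ _ lE.
have fy : f y = y.
  case/orP: xy => [/eqP <-|/eqP yx]; first by rewrite fK.
  case/orP: yz => [/eqP yz|/eqP <-]; last by rewrite fK.
  by rewrite -yx yz eqxx in xz.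
have fx : f x = y by case/orP: xy => /eqP // e; rewrite -e fy eqxx in nxy.
case/orP: lx => /eqP e.
  by have := fK (last z s); rewrite e fx => yx; rewrite yx eqxx in nxy.
have : y \in z :: s by rewrite -fx e inE.
by rewrite inE (negbTE nyz) (negbTE ys).
Qed.

End Idempotent.

(** The map sends a vertex to the designated center of its component. Respecting [C] matters on
    single-edge components, where the graph alone does not determine the center. *)
Lemma designated_center_map G C : center_designation G C ->
  exists h : T -> T, [/\ forall x, h (h x) = h x, edges G = star_edges h
    & forall x, x \in C -> h x = x].
Proof.
move=> [CG des].
have sym : connect_sym (adj G) by apply: sym_connect_sym => a b; apply: adjC.
(* The inner default is never reached, since the intersection is a singleton; vertices outside [G]
   become fixed points. *)
pose h x := if x \in verts G then
  odflt x [pick c in C :&: verts (component G x)] else x.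
have hP x : x \in verts G -> C :&: verts (component G x) = [set h x]
    /\ star_centered_at (component G x) (h x).
  move=> xG; have [c Cc cP] := des x xG; rewrite /h xG Cc.
  case: pickP => [d|/(_ c)]; last by rewrite set11.
  by rewrite inE => /eqP ->.
have hN x : x \notin verts G -> h x = x by rewrite /h => /negbTE ->.
have hc x : x \in verts G -> h x \in verts G /\ connect (adj G) x (h x).
  move=> /hP[/setP/(_ (h x))]; rewrite set11 !inE => /and3P[_ hG xh] _.
  by split.
have same x y : x \in verts G -> y \in verts G -> connect (adj G) x y ->
    h x = h y.
  move=> xG yG xy; apply: set1_inj; rewrite -(hP x xG).1 -(hP y yG).1.
  congr (_ :&: _); apply/setP => z; rewrite !inE; congr (_ && _).
  exact: same_connect.
(* The neighbors of the center lie among the other vertices of its component, and the degree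
   condition makes the two sets equally large. *)
have center_adj x y : x \in verts G -> y \in verts (component G x) ->
    y != h x -> adj (component G x) (h x) y.
  move=> xG yx yh; have [_ [_ hx deg _]] := hP x xG.
  have sub : [set z | adj (component G x) (h x) z] \subset
      verts (component G x) :\ h x.
    apply/subsetP => z; rewrite in_set => a.
    by rewrite in_setD1 eq_sym (adj_neq a); rewrite adjC in a; apply: adj_verts a.
  have /eqP e : [set z | adj (component G x) (h x) z] ==
      verts (component G x) :\ h x.
    rewrite eqEcard sub /=; move: deg.
    by rewrite /degree (cardsD1 (h x) (verts _)) hx add1n => -[->].
  by have := in_setD1 y (verts (component G x)) (h x); rewrite -e inE yx yh.
exists h; split.
- move=> x; have [xG|/hN e] := boolP (x \in verts G); last by rewrite !e.
  by have [hG xh] := hc x xG; rewrite -(same _ _ xG hG xh).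
- apply/setP => e; apply/idP/imsetP => [eG|[x + ->]]; last first.
    rewrite inE => hx; have [xG|/hN e'] := boolP (x \in verts G); last first.
      by rewrite e' eqxx in hx.
    have : adj (component G x) (h x) x.
      by apply: center_adj; rewrite // 1?eq_sym // !inE xG connect0.
    by rewrite /adj /= inE setUC => /andP[].
  have /cards2P[x [y [nxy exy]]] : #|e| == 2.
    by have := subsetP (edgesP G) _ eG; rewrite inE => /andP[].
  have axy : adj G x y by rewrite /adj /= -exy.
  have xG : x \in verts G := adj_verts axy.
  have yG : y \in verts G by rewrite adjC in axy; apply: adj_verts axy.
  have hxy : h x = h y by apply: same => //; apply: connect1.
  have [hx|hx] := eqVneq x (h x).
    by exists y; rewrite ?inE -hxy -hx // exy setUC.
  have [hy|hy] := eqVneq y (h x).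
    by exists x; rewrite ?inE -hy // eq_sym.
  (* If neither end were the center, [x] would be adjacent to both [h x] and [y], against its degree
     1. *)
  have xx : x \in verts (component G x) by rewrite !inE xG connect0.
  have yx : y \in verts (component G x) by rewrite !inE yG connect1.
  have [_ [_ _ _ /(_ x xx hx) /eqP/cards1P[z /setP zP]]] := hP x xG.
  have := zP (h x); rewrite !inE (adjC (component G x)) center_adj //.
  move=> /esym/eqP hz; have := zP y; rewrite !inE -hz (negbTE hy).
  by rewrite /adj /= inE -exy eG exy subUset !sub1set xx yx.
- move=> x xC; have xG := subsetP CG x xC.
  have := (hP x xG).1 => /setP/(_ x); rewrite !inE xC xG connect0.
  by move=> /esym/eqP.
Qed.

End StarGraph.

(** * Edge partitions and planarity in terms of star maps *)

Section StarGraphFamilies.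
Variable T : finType.

Lemma star_graphs_partition (m : nat) (f : 'I_m -> T -> T) :
  (forall x y, x != y -> exists i, (f i x == y) || (f i y == x)) ->
  (forall x y i j, x != y -> (f i x == y) || (f i y == x) ->
    (f j x == y) || (f j y == x) -> i = j) ->
  edge_partition (complete_graph T) (fun i => star_graph (f i)).
Proof.
move=> cover uniq_f; split=> [|i j].
  apply/setP => e; apply/bigcupP/idP => [[i _]|].
    exact/subsetP/star_edgesP.
  rewrite inE => /andP[_ /cards2P[x [y [xy ->]]]].
  by have [i fi] := cover x y xy; exists i; rewrite // adj_star_edges xy.
move=> ij; rewrite -setI_eq0; apply/eqP/setP => e; rewrite !inE.
apply/negP => /andP[ei ej].
have := subsetP (star_edgesP (f i)) _ ei.
rewrite inE => /andP[_ /cards2P[x [y [xy exy]]]].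
move: ei ej; rewrite exy !adj_star_edges xy /= => fi fj.
by rewrite (uniq_f _ _ _ _ xy fi fj) eqxx in ij.
Qed.

Lemma star_graphs_partitionE (m : nat) (F : 'I_m -> graph T)
    (f : 'I_m -> T -> T) :
  edge_partition (complete_graph T) F ->
  (forall i, edges (F i) = star_edges (f i)) ->
  (forall x y, x != y -> exists i, (f i x == y) || (f i y == x)) /\
  (forall x y i j, x != y -> (f i x == y) || (f i y == x) ->
    (f j x == y) || (f j y == x) -> i = j).
Proof.
move=> [cover disj] Ff; split=> [x y xy|x y i j xy fi fj].
  have : [set x; y] \in edges (complete_graph T).
    by rewrite inE subsetT cards2 xy.
  rewrite -cover => /bigcupP[i _]; rewrite Ff adj_star_edges xy => fi.
  by exists i.
apply: contraTeq isT => /disj; rewrite -setI_eq0 => /eqP/setP/(_ [set x; y]).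
by rewrite !inE !Ff !adj_star_edges xy fi fj.
Qed.

(** Edges of one star meet only at their center by general position, so separation is required only
    for edges with different centers. *)
Lemma star_graph_plane (R : realType) (q : T -> 'rV[R]_2) (f : T -> T) :
  general_position q -> (forall x, f (f x) = f x) ->
  (forall x y, f x != x -> f y != y -> f x != f y ->
    strictly_separated (q x) (q (f x)) (q y) (q (f y))) ->
  plane q (star_graph f).
Proof.
move=> gp fK sep i j k l ij kl.
have leaf a b z : [set a; b] \in edges (star_graph f) ->
    on_segment (q a) (q b) z -> exists x, [/\ f x != x,
      [set a; b] = [set x; f x] & on_segment (q (f x)) (q x) z].
  rewrite adj_star_edges => /andP[ab /orP[]/eqP e] abz.
    by exists a; rewrite e eq_sym; split=> //; apply: on_segmentC.
  by exists b; rewrite e setUC.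
move=> ne z /(leaf _ _ _ ij)[x [fx exy sx]] /(leaf _ _ _ kl)[y [fy eyy sy]].
rewrite exy eyy in ne *; have [fxy|fxy] := eqVneq (f x) (f y).
  exists (f x); first by rewrite !inE fxy eqxx !orbT.
  apply: segments_share_apex sx _; last by rewrite fxy; apply: sy.
  apply: general_position_cross => //.
    by apply: contraNneq ne => ->.
  by rewrite fxy.
by case: (strictly_separated_disjoint (sep x y fx fy fxy)
  (on_segmentC sx) (on_segmentC sy)).
Qed.

End StarGraphFamilies.

(** * The blow-up of a family of star maps *)

Section BlowUp.
Variables (T : finType) (k m : nat) (h : 'I_m -> T -> T) (own : T -> 'I_m).
Hypotheses (hK : forall i x, h i (h i x) = h i x)
  (hown : forall x, h (own x) x = x)
  (h_cover : forall x y, x != y -> exists i, (h i x == y) || (h i y == x))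
  (h_uniq : forall x y i j, x != y -> (h i x == y) || (h i y == x) ->
    (h j x == y) || (h j y == x) -> i = j).

(* In the copy j of the i-th star-forest the stars with an edge are centered at
   vertices (c, j); the star of (v, j) also takes the (v, l) with j < l when i is the
   index chosen for v. *)
Definition blowup (i : 'I_m) (j : 'I_k) (w : T * 'I_k) : T * 'I_k :=
  if (h i w.1 != w.1) || (i == own w.1) && (j < w.2)%N then (h i w.1, j) else w.

Lemma blowup_moved i j w : blowup i j w != w -> blowup i j w = (h i w.1, j).
Proof. by rewrite /blowup; case: ifP => // _; rewrite eqxx. Qed.

Lemma blowupK i j w : blowup i j (blowup i j w) = blowup i j w.
Proof.
have [e|/blowup_moved ->] := eqVneq (blowup i j w) w; first by rewrite !e.
by rewrite /blowup /= hK eqxx ltnn andbF.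
Qed.

Lemma blowup_eq i j x y : x != y -> blowup i j x = y ->
  [/\ h i x.1 = y.1, j = y.2
    & x.1 = y.1 -> i = own x.1 /\ (y.2 < x.2)%N].
Proof.
move=> xy; rewrite /blowup; case: ifP => [c <-|_ e]; last first.
  by rewrite e eqxx in xy.
by split=> //= e; move: c; rewrite -e eqxx /= => /andP[/eqP].
Qed.

(** Between clusters, the copy is the index of the endpoint lying over the center; inside the
    cluster of [v], the forest is [own v] and the copy is the smaller index. *)
Lemma blowup_cover x y : x != y ->
  exists i j, (blowup i j x == y) || (blowup i j y == x).
Proof.
case: x y => [x a] [y b] xy.
have [exy|nxy] := eqVneq x y.
  move: xy; rewrite -exy xpair_eqE eqxx /= neq_ltn => /orP[ab|ba].
    by exists (own x), a; rewrite orbC /blowup /= hown ab !eqxx /= ?eqxx.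
  by exists (own x), b; rewrite /blowup /= hown ba !eqxx /= ?eqxx.
have [i /orP[]/eqP e] := h_cover nxy.
  by exists i, b; rewrite /blowup /= e [y == x]eq_sym nxy eqxx.
by exists i, a; rewrite /blowup /= e nxy eqxx orbT.
Qed.

Lemma blowup_uniq x y i i' j j' : x != y ->
  (blowup i j x == y) || (blowup i j y == x) ->
  (blowup i' j' x == y) || (blowup i' j' y == x) -> i = i' /\ j = j'.
Proof.
move=> xy; have yx : y != x by rewrite eq_sym.
(* The target determines the copy; the forest is determined by [own] inside a cluster and by
   [h_uniq] between clusters. *)
have arrow u v a b a' b' : u != v -> blowup a b u = v ->
    blowup a' b' u = v -> a = a' /\ b = b'.
  move=> uv /(blowup_eq uv)[e1 -> e2] /(blowup_eq uv)[e1' -> e2'].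
  have [e|ne] := eqVneq u.1 v.1.
    by rewrite (e2 e).1 (e2' e).1.
  by split=> //; apply: (h_uniq ne); rewrite ?e1 ?e1' eqxx.
(* Opposite arrows are impossible: inside a cluster the index strictly decreases, and between
   clusters a single idempotent [h a] would have to swap two vertices. *)
have clash u v a b a' b' : u != v -> blowup a b u = v ->
    blowup a' b' v = u -> False.
  move=> uv /(blowup_eq uv)[e1 _ e2].
  rewrite eq_sym in uv; move=> /(blowup_eq uv)[e1' _ e2'].
  have [e|ne] := eqVneq u.1 v.1.
    by have := ltn_trans (e2 e).2 (e2' (esym e)).2; rewrite ltnn.
  have aa : a = a' by apply: (h_uniq ne); rewrite ?e1 ?e1' eqxx ?orbT.
  by move: ne; rewrite -e1' -aa -e1 hK eqxx.
move=> /orP[]/eqP e /orP[]/eqP e'.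
- exact: arrow xy e e'.
- by case: (clash _ _ _ _ _ _ xy e e').
- by case: (clash _ _ _ _ _ _ yx e e').
- exact: arrow yx e e'.
Qed.

(** This is the limit position, with each cluster collapsed to one point. Different centers in the
    same copy lie over different vertices, so the segments collapse to points or edges of different
    stars of one plane forest. *)
Lemma blowup_separated (R : realType) (p : T -> 'rV[R]_2) i j x y :
  general_position p -> plane p (star_graph (h i)) ->
  blowup i j x != x -> blowup i j y != y -> blowup i j x != blowup i j y ->
  strictly_separated (p x.1) (p (blowup i j x).1)
    (p y.1) (p (blowup i j y).1).
Proof.
move=> gp plane_h /blowup_moved -> /blowup_moved -> /=.
move: x.1 y.1 => a b; rewrite xpair_eqE eqxx andbT => hab.
apply: disjoint_segments_separated => //.
- by apply: contraNneq hab => ->.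
- by apply: contraNneq hab => ->; rewrite hK.
- by apply: contraNneq hab => <-; rewrite hK.
move=> ha hb z za zb.
have [|||u] := plane_h a (h i a) b (h i b) _ _ _ z za zb.
- by rewrite adj_star_edges ha eqxx.
- by rewrite adj_star_edges hb eqxx.
- apply: contraNneq hab => /eq_set2[[-> _ //]|[-> _]]; by rewrite hK.
rewrite !inE => /andP[ua ub] _; case/eqP: hab.
(* A common endpoint [u] would have both centers as its image under [h i]. *)
transitivity (h i u); first by case/orP: ua => /eqP ->; rewrite ?hK.
by case/orP: ub => /eqP ->; rewrite ?hK.
Qed.

End BlowUp.

(** * Relabeling of vertices and forests, and the final construction *)

Lemma ord_prod_bij (k n : nat) :
  exists (pi : 'I_(k * n) -> 'I_n * 'I_k) (rho : 'I_n * 'I_k -> 'I_(k * n)),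
    cancel pi rho /\ cancel rho pi.
Proof.
have e : (k * n)%N = #|{: 'I_n * 'I_k}| by rewrite card_prod !card_ord mulnC.
exists (enum_val \o cast_ord e), (cast_ord (esym e) \o enum_rank).
by split=> x /=; rewrite ?enum_valK ?cast_ordK ?cast_ordKV ?enum_rankK.
Qed.

Theorem theorem2 (R : realType) (c : R) (n0 m : nat) :
  1 / 2 < c < 1 ->
  (0 < n0)%N ->
  c * n0%:R = m%:R ->
  (exists (p : 'I_n0 -> 'rV[R]_2) (F : 'I_m -> graph 'I_n0)
          (C : 'I_m -> {set 'I_n0}),
     [/\ general_position p,
         plane_star_forest_partition p F,
         forall i, center_designation (F i) (C i)
       & forall v, exists i, v \in C i]) ->
  forall k : nat, (1 <= k)%N ->
  exists2 N : nat, c * k%:R * n0%:R = N%:R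
    & exists (p : 'I_(k * n0) -> 'rV[R]_2) (F : 'I_N -> graph 'I_(k * n0)),
        general_position p /\ plane_star_forest_partition p F.
Proof.
move=> _ _ cm [p [F [C [gp [part F_plane] des own_ex]]]] k _.
exists (k * m)%N; first by rewrite mulrAC cm natrM mulrC.
have [h hP] : exists h : 'I_m -> 'I_n0 -> 'I_n0,
    forall i, [/\ forall x, h i (h i x) = h i x,
      edges (F i) = star_edges (h i) & forall x, x \in C i -> h i x = x].
  exact: (fin_all_exists (fun i => designated_center_map (des i))).
have hK i x : h i (h i x) = h i x by case: (hP i).
have Fh i : edges (F i) = star_edges (h i) by case: (hP i).
have h_plane i : plane p (star_graph (h i)).
  by have := (F_plane i).2; rewrite /plane Fh.
have [own hown] : exists own : 'I_n0 -> 'I_m, forall v, h (own v) v = v.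
  apply: (@fin_all_exists _ (fun=> _) (fun v i => h i v = v)) => v; have [i iC] := own_ex v.
  by exists i; case: (hP i) => _ _; apply.
have [h_cover h_uniq] := star_graphs_partitionE part Fh.
have [pi [rho [piK rhoK]]] := ord_prod_bij k n0.
have [idx [xdi [idxK xdiK]]] := ord_prod_bij k m.
pose g i := blowup h own (idx i).1 (idx i).2.
pose f i w := rho (g i (pi w)).
have fK i w : f i (f i w) = f i w by rewrite /f rhoK /g blowupK.
have f_moved i w : f i w != w -> g i (pi w) != pi w.
  by apply: contraNneq => e; rewrite /f e piK.
have f_eq i x y : (f i x == y) = (g i (pi x) == pi y).
  by rewrite /f (can2_eq rhoK piK).
(* Every vertex starts at the point of its cluster and moves with its own label as parameter, so
   that all parameters are distinct. *)
pose q t w := perturb (p (pi w).1) (w : nat)%:R t : 'rV[R]_2.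
have natI : injective (fun w : 'I_(k * n0) => (w : nat)%:R : R).
  by move=> x y /eqP; rewrite eqr_nat => /eqP/val_inj.
(* There are finitely many conditions, each valid for all small positive [t], so one [t] meets them
   all. *)
have [t [t_gp t_sep]] : exists t, general_position (q t) /\
    forall w : 'I_(k * m) * 'I_(k * n0) * 'I_(k * n0),
      [&& f w.1.1 w.1.2 != w.1.2, f w.1.1 w.2 != w.2
        & f w.1.1 w.1.2 != f w.1.1 w.2] ->
      strictly_separated (q t w.1.2) (q t (f w.1.1 w.1.2))
        (q t w.2) (q t (f w.1.1 w.2)).
  apply: for_small_pos_ex.
  apply: for_small_pos_and; first exact: perturb_general_position.
  apply: for_small_pos_forall => -[[i x] y] /=.
  apply: for_small_pos_implyl => /and3P[fx fy fxy].
  apply: perturb_strictly_separated.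
  have := @blowup_separated _ _ _ _ own hK _ p (idx i).1 (idx i).2 (pi x) (pi y).
  rewrite /f !rhoK; apply=> //; try exact: f_moved.
  by apply: contraNneq fxy; rewrite /f /g => ->.
exists (q t), (fun i => star_graph (f i)); split=> //; split=> [|i]; last first.
  split; first exact: star_graph_forest.
  apply: star_graph_plane => // x y fx fy fxy.
  by apply: (t_sep (i, x, y)); rewrite /= fx fy.
have pi_neq x y : x != y -> pi x != pi y by rewrite (can_eq piK).
apply: star_graphs_partition => [x y xy|x y i i' /pi_neq xy].
  have [i [j ij]] := blowup_cover hown h_cover (pi_neq _ _ xy).
  by exists (xdi (i, j)); rewrite !f_eq /g xdiK.
rewrite !f_eq => gi gi'; apply: (can_inj idxK).
have [e1 e2] := blowup_uniq hK h_uniq xy gi gi'.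
by rewrite [LHS]surjective_pairing e1 e2 -surjective_pairing.
Qed.
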